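(* Suppose that the initial-boundary value problem $$u_\tau-\tfrac12\sigma^2S^2u_{SS}+a e^{u}e^{-v}-b=0,\qquad v_\tau+c\,e^{v}e^{-u}-c=0\qquad\text{on } Q_T=[0,T]\times[0,S_{\max}],$$ $$u(0,S)=v(0,S)=\gamma h(S)\ (0\le S\le S_{\max}),\qquad u(\tau,0)=\varphi_l(\tau),\quad u(\tau,S_{\max})=\varphi_r(\tau)\ (0\le\tau\le T),$$ has a classical solution $(u,v)$ with $u,v\in C^{2,4}(Q_T)$. For a mesh with steps $\triangle S,\triangle\tau$, let $(U,V)$ be the grid functions determined by the implicit-explicit linearised scheme $$\frac{U_i^{j+1}-U_i^j}{\triangle\tau}-\frac12\sigma^2S_i^2\,\frac{U_{i-1}^{j+1}-2U_i^{j+1}+U_{i+1}^{j+1}}{(\triangle S)^2}+a e^{U_i^j-V_i^j}\left(1+V_i^j-U_i^j+U_i^{j+1}-V_i^{j+1}\right)-b=0,\quad 1\le i\le I-1,$$ $$\frac{V_i^{j+1}-V_i^j}{\triangle\tau}+c\,e^{V_i^j-U_i^j}\left(1-V_i^j+U_i^j+V_i^{j+1}-U_i^{j+1}\right)-c=0,\quad 0\le i\le I,$$ for $0\le j\le J-1$, together with $$U_i^0=V_i^0=\gamma h(S_i)\ (0\le i\le I),\qquad U_0^j=\varphi_l(\tau_j),\quad U_I^j=\varphi_r(\tau_j)\ (0\le j\le J).$$ Then for sufficiently small $\triangle S$ and $\triangle\tau$ the error estimate $$\max_{0\le i\le I,\,0\le j\le J}|u(\tau_j,S_i)-U_i^j|+\max_{0\le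 i\le I,\,0\le j\le J}|v(\tau_j,S_i)-V_i^j|\le C\left(\triangle\tau+(\triangle S)^2\right)$$ holds, where the constant $C$ does not depend on $\triangle S$ and $\triangle\tau$. (That is, there exist $C,\delta>0$ such that the estimate holds for every mesh with $\triangle S\le\delta$ and $\triangle\tau\le\delta$.)
   Context: Constants: $\sigma,\gamma,T,S_{\max}>0$; $a=\nu_{01}>0$, $c=\nu_{10}>0$, $b=d_0+\nu_{01}$ with $d_0=\mu^2/(2\sigma^2)\ge0$, $\mu$ real. $h$ is a given function on $[0,S_{\max}]$ (the option payoff), and $\varphi_l,\varphi_r$ are given functions on $[0,T]$ (the boundary data). Uniform mesh: $S_i=i\triangle S$, $i=0,\dots,I$, with $I\triangle S=S_{\max}$, and $\tau_j=j\triangle\tau$, $j=0,\dots,J$, with $J\triangle\tau=T$ ($I\ge2$, $J\ge1$ integers). $C^{2,4}(Q_T)$ is the space of functions $w(\tau,S)$ on $Q_T$ such that all partial derivatives $\partial_S^i\partial_\tau^j w$ with $i+2j\le4$ exist and are continuous on $Q_T$. *)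

(* Defs.v *)
From Coquelicot Require Import Coquelicot.
From Stdlib Require Import Reals RList List.
Open Scope R_scope.

Definition Icc (a b x : R) : Prop := a <= x <= b.

(* Points of Q_T = [0,T] x [0,Smax] are pairs (t, s), time first. *)
Definition QT (T Smax : R) (p : R * R) : Prop :=
  Icc 0 T (fst p) /\ Icc 0 Smax (snd p).

(* Partial derivatives on the closed rectangle: [D_in] takes the difference
   quotient within the interval, so derivatives are one-sided at its end
   points, and values of w outside the rectangle play no role. *)
Definition is_dtau (T Smax : R) (w wt : R -> R -> R) : Prop :=
  forall t s : R, QT T Smax (t, s) ->
    D_in (fun x => w x s) (fun x => wt x s) (Icc 0 T) t.

Definition is_dS (T Smax : R) (w ws : R -> R -> R) : Prop :=
  forall t s : R, QT T Smax (t, s) ->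
    D_in (fun y => w t y) (fun y => ws t y) (Icc 0 Smax) s.

(* The space C^{2,4}(Q_T); D i j is the derivative d_S^i d_tau^j w. *)
Definition C24 (T Smax : R) (w : R -> R -> R) : Prop :=
  exists D : nat -> nat -> R -> R -> R,
    (forall t s, QT T Smax (t, s) -> D 0%nat 0%nat t s = w t s) /\
    (forall j, (2 * (j + 1) <= 4)%nat ->
       is_dtau T Smax (D 0%nat j) (D 0%nat (j + 1)%nat)) /\
    (forall i j, (i + 1 + 2 * j <= 4)%nat ->
       is_dS T Smax (D i j) (D (i + 1)%nat j)) /\
    (forall i j, (i + 2 * j <= 4)%nat ->
       continuous_on (QT T Smax) (fun p : R * R => D i j (fst p) (snd p))).

Definition is_IBVP_solution (sigma gamma T Smax a b c : R)
    (h phi_l phi_r : R -> R) (u v : R -> R -> R) : Prop :=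
  (exists ut us uss vt : R -> R -> R,
     is_dtau T Smax u ut /\ is_dS T Smax u us /\ is_dS T Smax us uss /\
     is_dtau T Smax v vt /\
     forall t s, QT T Smax (t, s) ->
       ut t s - 1 / 2 * sigma ^ 2 * s ^ 2 * uss t s
         + a * exp (u t s) * exp (- v t s) - b = 0 /\
       vt t s + c * exp (v t s) * exp (- u t s) - c = 0) /\
  (forall s, Icc 0 Smax s -> u 0 s = gamma * h s /\ v 0 s = gamma * h s) /\
  (forall t, Icc 0 T t -> u t 0 = phi_l t /\ u t Smax = phi_r t).

(* Uniform mesh s_i = i dS (0 <= i <= I), t_j = j dt (0 <= j <= J). *)
Definition is_mesh (T Smax : R) (I J : nat) (dS dt : R) : Prop :=
  (2 <= I)%nat /\ (1 <= J)%nat /\ INR I * dS = Smax /\ INR J * dt = T.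

(* Grid functions are maps nat -> nat -> R; U i j stands for U_i^j and only the
   values with i <= I, j <= J are relevant. *)
Definition is_scheme_solution (sigma gamma a b c : R) (h phi_l phi_r : R -> R)
    (I J : nat) (dS dt : R) (U V : nat -> nat -> R) : Prop :=
  (forall i j, (1 <= i <= I - 1)%nat -> (j <= J - 1)%nat ->
     (U i (j + 1)%nat - U i j) / dt
       - 1 / 2 * sigma ^ 2 * (INR i * dS) ^ 2
         * ((U (i - 1)%nat (j + 1)%nat - 2 * U i (j + 1)%nat
             + U (i + 1)%nat (j + 1)%nat) / dS ^ 2)
       + a * exp (U i j - V i j)
         * (1 + V i j - U i j + U i (j + 1)%nat - V i (j + 1)%nat)
       - b = 0) /\
  (forall i j, (i <= I)%nat -> (j <= J - 1)%nat ->
     (V i (j + 1)%nat - V i j) / dt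
       + c * exp (V i j - U i j)
         * (1 - V i j + U i j + V i (j + 1)%nat - U i (j + 1)%nat)
       - c = 0) /\
  (forall i, (i <= I)%nat ->
     U i 0%nat = gamma * h (INR i * dS) /\
     V i 0%nat = gamma * h (INR i * dS)) /\
  (forall j, (j <= J)%nat ->
     U 0%nat j = phi_l (INR j * dt) /\ U I j = phi_r (INR j * dt)).

(* The maximum of F i j over 0 <= i <= I, 0 <= j <= J. *)
Definition grid_max (I J : nat) (F : nat -> nat -> R) : R :=
  MaxRlist (List.map (fun p => F (fst p) (snd p))
                (list_prod (List.seq 0 (I + 1)) (List.seq 0 (J + 1)))).

(* Main.v *)
(* The errors e = u - U and f = v - V satisfy an implicit linear system whose
   coupling terms a exp(U-V) (e - f) and c exp(V-U) (f - e) at the new time level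
   have the sign required by a discrete maximum principle, whatever the time step.
   If G_j bounds |e| and |f| at level j and G_j <= 1, the explicit remainder of the
   linearised exponentials is at most L G_j plus the truncation error
   rho = O(dt + dS^2), so G_{j+1} = (1 + L dt) G_j + dt rho is a bound at the next
   level. Gronwall gives G_j <= T rho exp(L T); small steps keep this below 1 and
   close the induction. *)
Require Import Defs.
From Coquelicot Require Import Coquelicot.
From Stdlib Require Import Reals Lra Lia RList List ClassicalEpsilon.
Open Scope R_scope.

(** * One-sided derivatives and the mean value theorem on a closed interval *)

(** Nearest-point retraction of the line onto [[A, B]]; composing with it extends a function known
    only there continuously past the end points. *)
Definition clamp (A B z : R) : R := Rmax A (Rmin B z).

Lemma clamp_id (A B z : R) : Icc A B z -> clamp A B z = z.
Proof. intros [H1 H2]. unfold clamp. rewrite Rmin_right by lra. apply Rmax_right; lra. Qed.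

Lemma clamp_Icc (A B z : R) : A <= B -> Icc A B (clamp A B z).
Proof.
  intros H. unfold clamp, Icc. split; [apply Rmax_l|].
  apply Rmax_lub; [lra|apply Rmin_l].
Qed.

Lemma clamp_dist (A B x z : R) : Icc A B x -> Rabs (clamp A B z - x) <= Rabs (z - x).
Proof.
  intros [H1 H2]. unfold clamp, Rmax, Rmin.
  repeat destruct Rle_dec; unfold Rabs; repeat destruct Rcase_abs; lra.
Qed.

Lemma D_in_limit (f d : R -> R) (D : R -> Prop) (x eps : R) :
  D_in f d D x -> 0 < eps ->
  exists alp, 0 < alp /\
    forall y, D y -> y <> x -> Rabs (y - x) < alp ->
      Rabs ((f y - f x) / (y - x) - d x) < eps.
Proof.
  intros H He. destruct (H eps He) as [alp [Ha Hl]].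
  exists alp; split; [exact Ha|]. intros y Dy Hn Hd.
  apply (Hl y). repeat split; auto.
Qed.

(** Needed because [C24] identifies [D 0 0] with [w] on the rectangle only. *)
Lemma D_in_congr (f g d e : R -> R) (D : R -> Prop) (x : R) :
  D x -> (forall y, D y -> f y = g y) -> d x = e x -> D_in f d D x -> D_in g e D x.
Proof.
  intros Dx Hfg Hde H eps He. destruct (H eps He) as [alp [Ha Hl]].
  exists alp; split; [exact Ha|]. intros y [[Dy Hn] Hd].
  rewrite <- !Hfg, <- Hde by assumption. apply Hl. repeat split; auto.
Qed.

Lemma D_in_is_derive (f d : R -> R) (D : R -> Prop) (x : R) :
  is_derive f x (d x) -> D_in f d D x.
Proof.
  intros H. apply is_derive_Reals, derivable_pt_lim_D_in in H.
  intros eps He. destruct (H eps He) as [alp [Ha Hl]].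
  exists alp; split; [exact Ha|]. intros y [[Dy Hn] Hd].
  apply Hl. repeat split; auto.
Qed.

(** Each point of a nondegenerate interval is a limit point of it. This reconciles the derivatives
    named by the boundary value problem with those supplied by [C24]. *)
Lemma D_in_Icc_unique (A B x : R) (f d e : R -> R) :
  A < B -> Icc A B x -> D_in f d (Icc A B) x -> D_in f e (Icc A B) x -> d x = e x.
Proof.
  intros HAB [H1 H2] Hd He.
  refine (single_limit _ _ _ _ _ _ Hd He).
  intros alp Halp.
  (* The nearby point lies to the right of [x], except at [x = B], where it lies to the left; the
     minimum keeps it in the interval. *)
  destruct (Rlt_dec x B) as [Hx|Hx].
  - exists (x + Rmin (alp / 2) (B - x)).
    assert (0 < Rmin (alp/2) (B - x)) by (apply Rmin_pos; lra).
    pose proof (Rmin_l (alp/2) (B - x)). pose proof (Rmin_r (alp/2) (B - x)).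
    unfold D_x, Icc, Rdist. repeat split; try lra.
    rewrite Rabs_pos_eq; lra.
  - exists (x - Rmin (alp / 2) (x - A)).
    assert (0 < Rmin (alp/2) (x - A)) by (apply Rmin_pos; lra).
    pose proof (Rmin_l (alp/2) (x - A)). pose proof (Rmin_r (alp/2) (x - A)).
    unfold D_x, Icc, Rdist. repeat split; try lra.
    rewrite <- Rabs_Ropp, Rabs_pos_eq; lra.
Qed.

(* [f] is composed with [clamp] because the library theorem needs two-sided
   continuity at the end points. *)
Lemma D_in_MVT (A B x y : R) (f d : R -> R) :
  (forall z, Icc A B z -> D_in f d (Icc A B) z) -> Icc A B x -> Icc A B y ->
  exists z, Icc A B z /\ Rabs (z - x) <= Rabs (y - x) /\ f y - f x = d z * (y - x).
Proof.
  intros H Hx Hy.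
  assert (HAB : A <= B) by (destruct Hx; lra).
  destruct (MVT_gen (fun z => f (clamp A B z)) x y d) as [z [Hz E]].
  - intros z Hz.
    assert (Hz' : A < z < B).
    { destruct Hx, Hy. revert Hz. unfold Rmin, Rmax. destruct Rle_dec; lra. }
    apply is_derive_Reals. intros eps He.
    assert (Hzi : Icc A B z) by (unfold Icc; lra).
    destruct (D_in_limit _ _ _ _ _ (H z Hzi) He) as [alp [Ha Hl]].
    assert (Hp : 0 < Rmin alp (Rmin (z - A) (B - z))) by (repeat apply Rmin_pos; lra).
    exists (mkposreal _ Hp). simpl. intros k Hk0 Hk.
    pose proof (Rmin_l alp (Rmin (z - A) (B - z))).
    pose proof (Rmin_r alp (Rmin (z - A) (B - z))).
    pose proof (Rmin_l (z - A) (B - z)). pose proof (Rmin_r (z - A) (B - z)).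
    assert (Hki : Icc A B (z + k)) by (apply Rabs_def2 in Hk; unfold Icc; lra).
    rewrite !clamp_id by assumption.
    replace k with (z + k - z) at 2 by ring. apply Hl; try assumption; [lra|].
    replace (z + k - z) with k by ring. lra.
  - intros z Hz.
    assert (Hzi : Icc A B z).
    { destruct Hx, Hy. revert Hz. unfold Icc, Rmin, Rmax. destruct Rle_dec; lra. }
    intros eps He.
    destruct (cont_deriv _ _ _ _ (H z Hzi) eps He) as [alp [Ha Hl]].
    exists alp; split; [exact Ha|]. intros w [_ Hw].
    rewrite (clamp_id A B z Hzi).
    (* The retraction may send [w] to [z] itself, a point that the punctured limit [D_in] does not
       cover. *)
    destruct (Req_dec (clamp A B w) z) as [->|Hn].
    + unfold dist; simpl. rewrite Rdist_eq. exact He.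
    + apply Hl. split.
      * split; [apply clamp_Icc; exact HAB|auto].
      * eapply Rle_lt_trans; [apply clamp_dist; exact Hzi|exact Hw].
  - exists z. rewrite !clamp_id in E by assumption.
    destruct Hx, Hy. revert Hz. unfold Icc, Rmin, Rmax.
    destruct Rle_dec; intros Hz; (split; [lra|split; [|exact E]]);
    unfold Rabs; repeat destruct Rcase_abs; lra.
Qed.

(** * Taylor estimates and the second difference *)

(** The mean value theorem for [f - p], which vanishes at [x], raises the order of contact by one.
    Factorials are given up, so [M] stays the same through all orders. *)
Lemma D_in_taylor_step (A B x M : R) (n : nat) (f d p q : R -> R) :
  0 <= M -> Icc A B x -> f x = p x ->
  (forall z, Icc A B z -> D_in f d (Icc A B) z) ->
  (forall z, is_derive p z (q z)) ->
  (forall z, Icc A B z -> Rabs (d z - q z) <= M * Rabs (z - x) ^ n) ->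
  forall y, Icc A B y -> Rabs (f y - p y) <= M * Rabs (y - x) ^ S n.
Proof.
  intros HM Hx H0 HD Hp Hd y Hy.
  destruct (D_in_MVT A B x y (fun z => f z - p z) (fun z => d z - q z))
    as [z [Hz [Hzx E]]]; try assumption.
  { intros z Hz. apply Dminus; [auto|]. apply D_in_is_derive; auto. }
  replace (f y - p y) with ((d z - q z) * (y - x)) by (rewrite <- E, H0; ring).
  rewrite Rabs_mult. simpl.
  rewrite (Rmult_comm (Rabs (y - x))), <- Rmult_assoc.
  apply Rmult_le_compat_r; [apply Rabs_pos|].
  eapply Rle_trans; [apply Hd; exact Hz|].
  apply Rmult_le_compat_l; [exact HM|].
  apply pow_incr. split; [apply Rabs_pos|exact Hzx].
Qed.

Lemma D_in_taylor2 (A B x M : R) (f0 f1 f2 : R -> R) :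
  0 <= M -> Icc A B x ->
  (forall z, Icc A B z -> D_in f0 f1 (Icc A B) z) ->
  (forall z, Icc A B z -> D_in f1 f2 (Icc A B) z) ->
  (forall z, Icc A B z -> Rabs (f2 z) <= M) ->
  forall y, Icc A B y ->
    Rabs (f0 y - (f0 x + f1 x * (y - x))) <= M * Rabs (y - x) ^ 2.
Proof.
  intros HM Hx H0 H1 H2.
  apply (D_in_taylor_step A B x M 1 f0 f1
    (fun z => f0 x + f1 x * (z - x)) (fun _ => f1 x)); try assumption; [ring| |].
  { intros z. auto_derive; [exact I|ring]. }
  apply (D_in_taylor_step A B x M 0 f1 f2
    (fun _ => f1 x) (fun _ => 0)); try assumption; [reflexivity| |].
  { intros z. apply (is_derive_const (f1 x) z). }
  intros z Hz. rewrite Rminus_0_r, pow_O, Rmult_1_r. auto.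
Qed.

Lemma D_in_taylor4 (A B x M : R) (f0 f1 f2 f3 f4 : R -> R) :
  0 <= M -> Icc A B x ->
  (forall z, Icc A B z -> D_in f0 f1 (Icc A B) z) ->
  (forall z, Icc A B z -> D_in f1 f2 (Icc A B) z) ->
  (forall z, Icc A B z -> D_in f2 f3 (Icc A B) z) ->
  (forall z, Icc A B z -> D_in f3 f4 (Icc A B) z) ->
  (forall z, Icc A B z -> Rabs (f4 z) <= M) ->
  forall y, Icc A B y ->
    Rabs (f0 y - (f0 x + f1 x * (y - x) + f2 x * (y - x) ^ 2 / 2
                  + f3 x * (y - x) ^ 3 / 6)) <= M * Rabs (y - x) ^ 4.
Proof.
  intros HM Hx H0 H1 H2 H3 H4.
  apply (D_in_taylor_step A B x M 3 f0 f1
    (fun z => f0 x + f1 x * (z - x) + f2 x * (z - x) ^ 2 / 2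
              + f3 x * (z - x) ^ 3 / 6)
    (fun z => f1 x + f2 x * (z - x) + f3 x * (z - x) ^ 2 / 2));
    try assumption; [field| |].
  { intros z. auto_derive; [exact I|field]. }
  apply (D_in_taylor_step A B x M 2 f1 f2
    (fun z => f1 x + f2 x * (z - x) + f3 x * (z - x) ^ 2 / 2)
    (fun z => f2 x + f3 x * (z - x))); try assumption; [field| |].
  { intros z. auto_derive; [exact I|field]. }
  apply D_in_taylor2 with (f2 := f4); assumption.
Qed.

(** In the sum of the Taylor expansions at [x - k] and [x + k] the odd terms cancel; each remainder
    contributes [M * k ^ 4]. *)
Lemma second_difference_bound (A B x k M : R) (f0 f1 f2 f3 f4 : R -> R) :
  0 <= M -> Icc A B x -> Icc A B (x - k) -> Icc A B (x + k) ->
  (forall z, Icc A B z -> D_in f0 f1 (Icc A B) z) ->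
  (forall z, Icc A B z -> D_in f1 f2 (Icc A B) z) ->
  (forall z, Icc A B z -> D_in f2 f3 (Icc A B) z) ->
  (forall z, Icc A B z -> D_in f3 f4 (Icc A B) z) ->
  (forall z, Icc A B z -> Rabs (f4 z) <= M) ->
  Rabs (f0 (x - k) - 2 * f0 x + f0 (x + k) - k ^ 2 * f2 x) <= 2 * M * k ^ 4.
Proof.
  intros HM Hx Hm Hp H0 H1 H2 H3 H4.
  pose proof (D_in_taylor4 A B x M f0 f1 f2 f3 f4 HM Hx H0 H1 H2 H3 H4) as T.
  pose proof (T _ Hm) as Tm. pose proof (T _ Hp) as Tp. clear T.
  replace (x - k - x) with (- k) in Tm by ring.
  replace (x + k - x) with k in Tp by ring.
  assert (Ek : Rabs k ^ 4 = k ^ 4).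
  { replace (Rabs k ^ 4) with ((Rabs k ^ 2) ^ 2) by ring.
    rewrite pow2_abs. ring. }
  rewrite Rabs_Ropp, Ek in Tm. rewrite Ek in Tp.
  apply Rabs_le_between in Tm, Tp. apply Rabs_le_between. lra.
Qed.

(** * Uniform bounds on the rectangle *)

(* The radius of continuity attached to a point is taken below [1 / (1 + |f|)]
   there, so that a Lebesgue number of the cover also bounds [f]. *)
Lemma continuous_on_QT_bounded (T Smax : R) (f : R * R -> R) :
  continuous_on (QT T Smax) f ->
  exists M, 0 <= M /\ forall p, QT T Smax p -> Rabs (f p) <= M.
Proof.
  intros H.
  assert (Hd : forall x y : R, exists d : posreal, d <= / (1 + Rabs (f (x, y))) /\
     (QT T Smax (x, y) -> forall x' y', QT T Smax (x', y') ->
        Rabs (x' - x) < d -> Rabs (y' - y) < d ->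
        Rabs (f (x', y') - f (x, y)) <= 1)).
  { intros x y.
    assert (Hi : 0 < / (1 + Rabs (f (x, y)))).
    { apply Rinv_0_lt_compat. pose proof (Rabs_pos (f (x, y))). lra. }
    destruct (classic (QT T Smax (x, y))) as [Hxy|Hxy].
    - pose proof (proj1 (filterlim_locally _ _) (H _ Hxy) (mkposreal 1 Rlt_0_1)) as [e He].
      assert (Hp : 0 < Rmin e (/ (1 + Rabs (f (x, y))))).
      { apply Rmin_pos; [apply cond_pos|exact Hi]. }
      exists (mkposreal _ Hp). simpl. split; [apply Rmin_r|].
      intros _ x' y' Hq Hx Hy. left.
      apply (He (x', y')); [|exact Hq].
      split; (eapply Rlt_le_trans; [eassumption|apply Rmin_l]).
    - exists (mkposreal _ Hi). simpl. split; [lra|]. intros Hc. contradiction. }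
  (* The compactness theorem takes a radius function, so the radii are selected by choice. *)
  pose (delta := fun x y =>
     proj1_sig (constructive_indefinite_description _ (Hd x y))).
  destruct (compactness_value_2d 0 T 0 Smax delta) as [d Hc].
  assert (Hdi : 0 < / d) by apply Rinv_0_lt_compat, cond_pos.
  (* Every point lies in the box of some centre whose radius is at least [d]; there [1 + |f|] is at
     most [/ d], and [f] varies by at most 1 within the box. *)
  exists (/ d + 1). split; [lra|].
  intros [x y] [Hx Hy].
  destruct (NNPP _ (Hc x y Hx Hy)) as (u & v & Hu & Hv & Hxu & Hyv & Hle).
  unfold delta in *.
  destruct (constructive_indefinite_description _ (Hd u v)) as [e [He1 He2]].
  simpl in *.
  specialize (He2 (conj Hu Hv) x y (conj Hx Hy) Hxu Hyv).
  assert (Hb : 1 + Rabs (f (u, v)) <= / d).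
  { rewrite <- (Rinv_inv (1 + Rabs (f (u, v)))).
    apply Rinv_le_contravar; [apply cond_pos|lra]. }
  pose proof (Rabs_triang (f (x, y) - f (u, v)) (f (u, v))) as Ht.
  replace (f (x, y) - f (u, v) + f (u, v)) with (f (x, y)) in Ht by ring.
  lra.
Qed.

(** Distils from the regularity of [w] the estimates that the convergence proof uses, with a single
    constant. *)
Lemma C24_bounds (T Smax : R) (w : R -> R -> R) :
  C24 T Smax w ->
  exists (wt ws wss : R -> R -> R) (M : R), 0 <= M /\
    is_dtau T Smax w wt /\ is_dS T Smax w ws /\ is_dS T Smax ws wss /\
    (forall t s, QT T Smax (t, s) -> Rabs (w t s) <= M) /\
    (forall t t' s, QT T Smax (t, s) -> QT T Smax (t', s) ->
       Rabs (w t' s - w t s) <= M * Rabs (t' - t)) /\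
    (forall t t' s, QT T Smax (t, s) -> QT T Smax (t', s) ->
       Rabs (w t' s - w t s - wt t s * (t' - t)) <= M * (t' - t) ^ 2) /\
    (forall t s k, QT T Smax (t, s) -> QT T Smax (t, s - k) ->
       QT T Smax (t, s + k) ->
       Rabs (w t (s - k) - 2 * w t s + w t (s + k) - k ^ 2 * wss t s)
         <= M * k ^ 4).
Proof.
  intros (D & D00 & Dt & Ds & Dc).
  assert (Hb : forall i j, (i + 2 * j <= 4)%nat ->
    exists M, 0 <= M /\ forall t s, QT T Smax (t, s) -> Rabs (D i j t s) <= M).
  { intros i j Hij.
    destruct (continuous_on_QT_bounded _ _ _ (Dc i j Hij)) as [M [H0 HM]].
    exists M; split; [exact H0|]. intros t s Hq. apply (HM (t, s) Hq). }
  destruct (Hb 0%nat 0%nat ltac:(lia)) as [M0 [P0 B0]].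
  destruct (Hb 0%nat 1%nat ltac:(lia)) as [M1 [P1 B1]].
  destruct (Hb 0%nat 2%nat ltac:(lia)) as [M2 [P2 B2]].
  destruct (Hb 4%nat 0%nat ltac:(lia)) as [M4 [P4 B4]].
  clear Hb.
  pose proof (Dt 0%nat ltac:(lia)) as Dt0. pose proof (Dt 1%nat ltac:(lia)) as Dt1.
  pose proof (Ds 0%nat 0%nat ltac:(lia)) as Ds0.
  pose proof (Ds 1%nat 0%nat ltac:(lia)) as Ds1.
  pose proof (Ds 2%nat 0%nat ltac:(lia)) as Ds2.
  pose proof (Ds 3%nat 0%nat ltac:(lia)) as Ds3.
  cbn [Nat.add] in *. clear Dt Ds Dc.
  (* [M0] bounds the values, [M1] the time increments, [M2] the time remainder and [2 * M4] the
     second difference error. *)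
  exists (D 0%nat 1%nat), (D 1%nat 0%nat), (D 2%nat 0%nat), (M0 + M1 + M2 + 2 * M4).
  split; [lra|]. split.
  { intros t s Hq. apply D_in_congr with (4 := Dt0 t s Hq); auto.
    - apply Hq.
    - intros y Hy. apply D00. split; [exact Hy|apply Hq]. }
  split.
  { intros t s Hq. apply D_in_congr with (4 := Ds0 t s Hq); auto.
    - apply Hq.
    - intros y Hy. apply D00. split; [apply Hq|exact Hy]. }
  split; [exact Ds1|]. split.
  { intros t s Hq. rewrite <- D00 by exact Hq. specialize (B0 t s Hq). lra. }
  split.
  { intros t t' s [Ht Hs] [Ht' _]. simpl in Ht, Hs, Ht'.
    rewrite <- !D00 by (split; assumption).
    destruct (D_in_MVT 0 T t t' (fun x => D 0%nat 0%nat x s)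
      (fun x => D 0%nat 1%nat x s)) as [z [Hz [_ E]]]; try assumption.
    { intros z Hz. apply Dt0. split; assumption. }
    rewrite E, Rabs_mult. apply Rmult_le_compat_r; [apply Rabs_pos|].
    specialize (B1 z s (conj Hz Hs)). lra. }
  split.
  { intros t t' s [Ht Hs] [Ht' _]. simpl in Ht, Hs, Ht'.
    rewrite <- !D00 by (split; assumption).
    pose proof (D_in_taylor2 0 T t M2 (fun x => D 0%nat 0%nat x s)
      (fun x => D 0%nat 1%nat x s) (fun x => D 0%nat 2%nat x s) P2 Ht) as Q.
    replace (D 0%nat 0%nat t' s - D 0%nat 0%nat t s - D 0%nat 1%nat t s * (t' - t))
      with (D 0%nat 0%nat t' s - (D 0%nat 0%nat t s + D 0%nat 1%nat t s * (t' - t)))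
      by ring.
    eapply Rle_trans; [apply Q; try assumption|].
    - intros z Hz. apply Dt0. split; assumption.
    - intros z Hz. apply Dt1. split; assumption.
    - intros z Hz. apply B2. split; assumption.
    - rewrite pow2_abs. apply Rmult_le_compat_r; [apply pow2_ge_0|lra]. }
  intros t s k [Ht Hs] [_ Hm] [_ Hp]. simpl in Ht, Hs, Hm, Hp.
  rewrite <- !D00 by (split; assumption).
  eapply Rle_trans.
  - apply (second_difference_bound 0 Smax s k M4 (D 0%nat 0%nat t) (D 1%nat 0%nat t)
      (D 2%nat 0%nat t) (D 3%nat 0%nat t) (D 4%nat 0%nat t)); try assumption;
      intros z Hz; [apply Ds0|apply Ds1|apply Ds2|apply Ds3|apply B4];
      split; assumption.
  - apply Rmult_le_compat_r; [|lra].
    replace (k ^ 4) with ((k ^ 2) ^ 2) by ring. apply pow2_ge_0.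
Qed.

(** * Discrete maximum principle for one implicit step *)

Lemma nat_argmax (n : nat) (g : nat -> R) :
  exists i, (i <= n)%nat /\ forall k, (k <= n)%nat -> g k <= g i.
Proof.
  induction n as [|n [i [Hi IH]]].
  - exists 0%nat. split; [lia|]. intros k Hk. replace k with 0%nat by lia. lra.
  - destruct (Rle_dec (g i) (g (S n))) as [H|H].
    + exists (S n). split; [lia|]. intros k Hk.
      destruct (Nat.eq_dec k (S n)) as [->|Hn]; [lra|].
      pose proof (IH k ltac:(lia)). lra.
    + exists i. split; [lia|]. intros k Hk.
      destruct (Nat.eq_dec k (S n)) as [->|Hn]; [lra|]. apply IH; lia.
Qed.

(* At a largest value among all [e' i] and [f' i] the second difference and the
   coupling term have the favourable sign. *)
Lemma implicit_step_upper (I : nat) (dt B K : R) (e f e' f' p q r : nat -> R) :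
  0 < dt -> 0 <= B -> 0 <= K ->
  (forall i, 0 <= p i) -> (forall i, 0 <= q i) -> (forall i, 0 <= r i) ->
  (forall i, (1 <= i <= I - 1)%nat ->
     (e' i - e i) / dt - p i * (e' (i - 1)%nat - 2 * e' i + e' (i + 1)%nat)
       + q i * (e' i - f' i) <= K) ->
  (forall i, (i <= I)%nat -> (f' i - f i) / dt + r i * (f' i - e' i) <= K) ->
  e' 0%nat = 0 -> e' I = 0 ->
  (forall i, (i <= I)%nat -> e i <= B /\ f i <= B) ->
  forall i, (i <= I)%nat -> e' i <= B + dt * K /\ f' i <= B + dt * K.
Proof.
  intros Hdt HB HK Hp Hq Hr He Hf H0 HI Hold.
  destruct (nat_argmax I (fun i => Rmax (e' i) (f' i))) as [m [Hm Hmax]].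
  assert (Hme : forall k, (k <= I)%nat -> e' k <= Rmax (e' m) (f' m)).
  { intros k Hk. eapply Rle_trans; [apply Rmax_l|apply (Hmax k Hk)]. }
  assert (Hmf : forall k, (k <= I)%nat -> f' k <= Rmax (e' m) (f' m)).
  { intros k Hk. eapply Rle_trans; [apply Rmax_r|apply (Hmax k Hk)]. }
  assert (HdK : 0 <= dt * K) by (apply Rmult_le_pos; lra).
  assert (Hquot : forall x y, (x - y) / dt <= K -> x <= y + dt * K).
  { intros x y Hxy. apply (Rmult_le_compat_l dt) in Hxy; [|lra].
    replace (dt * ((x - y) / dt)) with (x - y) in Hxy by (field; lra). lra. }
  assert (HR : Rmax (e' m) (f' m) <= B + dt * K).
  { destruct (Rle_dec (e' m) (f' m)) as [Hef|Hef].
    - rewrite Rmax_right in * by exact Hef.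
      pose proof (Hf m Hm) as E. pose proof (proj2 (Hold m Hm)).
      pose proof (Rmult_le_pos (r m) (f' m - e' m) (Hr m) ltac:(lra)).
      pose proof (Hquot (f' m) (f m) ltac:(lra)). lra.
    - rewrite Rmax_left in * by lra.
      destruct (Nat.eq_dec m 0) as [->|Hm0]; [lra|].
      destruct (Nat.eq_dec m I) as [->|HmI]; [lra|].
      pose proof (He m ltac:(lia)) as E. pose proof (proj1 (Hold m Hm)).
      pose proof (Rmult_le_pos (q m) (e' m - f' m) (Hq m) ltac:(lra)).
      pose proof (Hme (m - 1)%nat ltac:(lia)). pose proof (Hme (m + 1)%nat ltac:(lia)).
      pose proof (Rmult_le_pos (p m)
        (- (e' (m - 1)%nat - 2 * e' m + e' (m + 1)%nat)) (Hp m) ltac:(lra)).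
      pose proof (Hquot (e' m) (e m) ltac:(lra)). lra. }
  intros i Hi. specialize (Hme i Hi). specialize (Hmf i Hi). lra.
Qed.

(** The system is linear, so the one-sided bound applies to the errors and to their negatives. *)
Lemma implicit_step_bound (I : nat) (dt B K : R) (e f e' f' p q r : nat -> R) :
  0 < dt -> 0 <= B -> 0 <= K ->
  (forall i, 0 <= p i) -> (forall i, 0 <= q i) -> (forall i, 0 <= r i) ->
  (forall i, (1 <= i <= I - 1)%nat ->
     Rabs ((e' i - e i) / dt
           - p i * (e' (i - 1)%nat - 2 * e' i + e' (i + 1)%nat)
           + q i * (e' i - f' i)) <= K) ->
  (forall i, (i <= I)%nat ->
     Rabs ((f' i - f i) / dt + r i * (f' i - e' i)) <= K) ->
  e' 0%nat = 0 -> e' I = 0 ->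
  (forall i, (i <= I)%nat -> Rabs (e i) <= B /\ Rabs (f i) <= B) ->
  forall i, (i <= I)%nat ->
    Rabs (e' i) <= B + dt * K /\ Rabs (f' i) <= B + dt * K.
Proof.
  intros Hdt HB HK Hp Hq Hr He Hf H0 HI Hold i Hi.
  destruct (implicit_step_upper I dt B K e f e' f' p q r) with (i := i)
    as [U1 U2]; try assumption.
  { intros k Hk. eapply Rle_trans; [apply Rle_abs|apply He, Hk]. }
  { intros k Hk. eapply Rle_trans; [apply Rle_abs|apply Hf, Hk]. }
  { intros k Hk. destruct (Hold k Hk) as [A1 A2].
    apply Rabs_le_between in A1, A2. lra. }
  destruct (implicit_step_upper I dt B K (fun k => - e k) (fun k => - f k)
    (fun k => - e' k) (fun k => - f' k) p q r) with (i := i)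
    as [L1 L2]; try assumption.
  { intros k Hk. specialize (He k Hk). apply Rabs_le_between in He.
    unfold Rdiv in *. lra. }
  { intros k Hk. specialize (Hf k Hk). apply Rabs_le_between in Hf.
    unfold Rdiv in *. lra. }
  { lra. }
  { lra. }
  { intros k Hk. destruct (Hold k Hk) as [A1 A2].
    apply Rabs_le_between in A1, A2. lra. }
  split; apply Rabs_le_between; lra.
Qed.

(** * Linearisation of the exponential source *)

Lemma exp_lipschitz (N x y : R) :
  Rabs x <= N -> Rabs y <= N -> Rabs (exp y - exp x) <= exp N * Rabs (y - x).
Proof.
  intros Hx Hy.
  destruct (MVT_gen exp x y exp) as [z [Hz E]].
  - intros z _. apply is_derive_Reals, derivable_pt_lim_exp.
  - intros z _. apply derivable_continuous_pt, derivable_pt_exp.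
  - rewrite E, Rabs_mult. apply Rmult_le_compat_r; [apply Rabs_pos|].
    rewrite Rabs_pos_eq by (left; apply exp_pos).
    apply Rabs_le_between in Hx, Hy.
    assert (Hzn : z <= N) by (eapply Rle_trans; [apply Hz|apply Rmax_lub; lra]).
    destruct Hzn as [Hl| ->]; [left; apply exp_increasing; exact Hl|right; reflexivity].
Qed.

(** The mean value theorem turns the remainder into [(exp z - exp x) * (y - x)] with [z] between [x]
    and [y]; the Lipschitz bound gives the second factor [y - x]. *)
Lemma exp_linearisation (N x y : R) :
  Rabs x <= N -> Rabs y <= N ->
  Rabs (exp y - exp x * (1 + y - x)) <= exp N * (y - x) ^ 2.
Proof.
  intros Hx Hy.
  destruct (MVT_gen exp x y exp) as [z [Hz E]].
  - intros z _. apply is_derive_Reals, derivable_pt_lim_exp.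
  - intros z _. apply derivable_continuous_pt, derivable_pt_exp.
  - replace (exp y - exp x * (1 + y - x)) with ((exp z - exp x) * (y - x))
      by (replace (exp y) with (exp x + exp z * (y - x)) by lra; ring).
    rewrite Rabs_mult, <- pow2_abs. simpl. rewrite Rmult_1_r, <- Rmult_assoc.
    apply Rmult_le_compat_r; [apply Rabs_pos|].
    revert Hz. unfold Rmin, Rmax. intros Hz.
    eapply Rle_trans; [apply (exp_lipschitz N); [exact Hx|]|].
    + apply Rabs_le_between in Hx, Hy. apply Rabs_le_between.
      destruct Rle_dec; lra.
    + apply Rmult_le_compat_l; [left; apply exp_pos|].
      destruct Rle_dec; unfold Rabs; repeat destruct Rcase_abs; lra.
Qed.

(* [X], [X'] are exact values at consecutive levels, [x], [y] the discrete ones;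
   the implicit part [exp x * (X' - y)] is kept apart, since the maximum principle
   absorbs it without restriction on the time step. *)
Lemma linearised_source_error (N B X X' x y : R) :
  0 <= B <= 1 -> Rabs X <= N -> Rabs X' <= N -> Rabs (X - x) <= 2 * B ->
  Rabs (exp X' - exp x * (1 + y - x) - exp x * (X' - y))
    <= exp (N + 2) * (X' - X) ^ 2 + exp (N + 2) * (4 + 4 * N) * B.
Proof.
  intros HB HX HX' Hx.
  assert (HN : 0 <= N) by (pose proof (Rabs_pos X); lra).
  (* Here [B <= 1] enters: it confines the discrete argument to a fixed range, on which
     [exp (N + 2)] bounds the exponential. *)
  assert (Hxb : Rabs x <= N + 2).
  { pose proof (Rabs_triang X (- (X - x))) as Q.
    replace (X + - (X - x)) with x in Q by ring. rewrite Rabs_Ropp in Q. lra. }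
  pose proof (exp_linearisation (N + 2) X X' ltac:(lra) ltac:(lra)) as H1.
  pose proof (exp_lipschitz (N + 2) x X ltac:(lra) ltac:(lra)) as H2.
  pose proof (exp_pos (N + 2)) as HE. pose proof (exp_pos x) as Hex.
  assert (Hexb : exp x <= exp (N + 2)).
  { apply Rabs_le_between in Hxb. destruct (proj2 Hxb) as [Hl|Hl].
    - left; apply exp_increasing; exact Hl.
    - rewrite Hl; lra. }
  assert (H3 : Rabs (exp x * (X - x)) <= exp (N + 2) * (2 * B)).
  { rewrite Rabs_mult, (Rabs_pos_eq (exp x)) by lra.
    apply Rmult_le_compat; try lra. apply Rabs_pos. }
  assert (H4 : Rabs ((exp X - exp x) * (1 + (X' - X)))
               <= exp (N + 2) * (2 * B) * (1 + 2 * N)).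
  { rewrite Rabs_mult. apply Rmult_le_compat; try apply Rabs_pos.
    - eapply Rle_trans; [exact H2|]. apply Rmult_le_compat_l; lra.
    - apply Rabs_le_between in HX, HX'. apply Rabs_le_between. lra. }
  (* The discrete value [y] cancels. What remains is the Taylor remainder at [X] and two terms of
     size [B], whose factors [2] and [2 * (1 + 2 * N)] add up to [4 + 4 * N]. *)
  replace (exp X' - exp x * (1 + y - x) - exp x * (X' - y))
    with (exp X' - exp X * (1 + X' - X) - exp x * (X - x)
          + (exp X - exp x) * (1 + (X' - X))) by ring.
  apply Rabs_le_between in H1, H3, H4. apply Rabs_le_between. lra.
Qed.

(** * Grid maxima and the discrete Gronwall bound *)

Lemma grid_max_le (I J : nat) (F : nat -> nat -> R) (B : R) :
  (forall i j, (i <= I)%nat -> (j <= J)%nat -> F i j <= B) -> grid_max I J F <= B.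
Proof.
  intros H. unfold grid_max.
  assert (Hin : forall z, In z (map (fun p => F (fst p) (snd p))
     (list_prod (seq 0 (I + 1)) (seq 0 (J + 1)))) -> z <= B).
  { intros z Hz. apply in_map_iff in Hz. destruct Hz as [[i j] [<- Hij]].
    apply in_prod_iff in Hij. rewrite !in_seq in Hij. apply H; simpl; lia. }
  (* The maximum of a nonempty list is one of its entries; the node [(0, 0)] shows that the list is
     nonempty. *)
  apply Hin, MaxRlist_P2. exists (F 0%nat 0%nat).
  apply in_map_iff. exists (0%nat, 0%nat). split; [reflexivity|].
  apply in_prod_iff. rewrite !in_seq. lia.
Qed.

Lemma Rabs_div_le (x y d : R) : 0 < d -> Rabs x <= y * d -> Rabs (x / d) <= y.
Proof.
  intros Hd H. unfold Rdiv. rewrite Rabs_mult, (Rabs_pos_eq (/ d)).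
  - apply Rmult_le_reg_r with d; [exact Hd|].
    rewrite Rmult_assoc, Rinv_l by lra. lra.
  - left; apply Rinv_0_lt_compat; exact Hd.
Qed.

(** An explicit supersolution of the recursion [G_{j+1} = (1 + L dt) G_j + dt rho], [G_0 = 0]. *)
Definition gronwall_bound (L dt rho : R) (j : nat) : R :=
  INR j * dt * rho * exp (L * (INR j * dt)).

(** Since [1 + L dt <= exp (L dt)], passing to the next exponential absorbs the growth factor; the
    new term [dt * rho] is multiplied there by an exponential that is at least 1. *)
Lemma gronwall_bound_step (L dt rho : R) (j : nat) :
  0 <= L -> 0 <= dt -> 0 <= rho ->
  gronwall_bound L dt rho j + dt * (L * gronwall_bound L dt rho j + rho)
    <= gronwall_bound L dt rho (j + 1).
Proof.
  intros HL Hdt Hr. unfold gronwall_bound. rewrite plus_INR. simpl INR.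
  replace (L * ((INR j + 1) * dt)) with (L * dt + L * (INR j * dt)) by ring.
  rewrite exp_plus.
  pose proof (pos_INR j) as Hj.
  set (E := exp (L * (INR j * dt))).
  assert (HLd : 0 <= L * dt) by (apply Rmult_le_pos; lra).
  assert (HLj : 0 <= L * (INR j * dt)) by (repeat apply Rmult_le_pos; lra).
  assert (HE : 1 <= E) by (pose proof (exp_ineq1_le (L * (INR j * dt))); unfold E; lra).
  pose proof (exp_ineq1_le (L * dt)) as H1.
  assert (Hdr : 0 <= dt * rho) by (apply Rmult_le_pos; lra).
  assert (HA : 0 <= INR j * (dt * rho)) by (apply Rmult_le_pos; lra).
  assert (HEE : 1 <= exp (L * dt) * E).
  { replace 1 with (1 * 1) by ring. apply Rmult_le_compat; lra. }
  assert (H2 : (INR j * (dt * rho) * E) * (1 + L * dt)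
               <= (INR j * (dt * rho) * E) * exp (L * dt)).
  { apply Rmult_le_compat_l; [|exact H1]. apply Rmult_le_pos; lra. }
  assert (H3 : (dt * rho) * 1 <= (dt * rho) * (exp (L * dt) * E))
    by (apply Rmult_le_compat_l; assumption).
  lra.
Qed.

Lemma gronwall_bound_le (L dt rho T : R) (j : nat) :
  0 <= L -> 0 <= dt -> 0 <= rho -> INR j * dt <= T ->
  0 <= gronwall_bound L dt rho j <= T * rho * exp (L * T).
Proof.
  intros HL Hdt Hr HT. unfold gronwall_bound.
  assert (Hj : 0 <= INR j * dt) by (apply Rmult_le_pos; [apply pos_INR|exact Hdt]).
  pose proof (exp_pos (L * (INR j * dt))). pose proof (pos_INR j).
  split; [repeat apply Rmult_le_pos; lra|].
  apply Rmult_le_compat; try lra.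
  - apply Rmult_le_pos; lra.
  - apply Rmult_le_compat_r; lra.
  - destruct (Rmult_le_compat_l L _ _ HL HT) as [Hl|Hl].
    + left; apply exp_increasing; exact Hl.
    + rewrite Hl; lra.
Qed.

(** * Consistency: the error equation and its residual *)

(* The ordinary differential equation is the case [kappa = 0]. *)
Lemma scheme_residual (dt dS kappa a b M B w w' wm wp wt wss X X' x y W W' Wm Wp : R) :
  0 < dt <= 1 -> 0 < dS -> 0 <= kappa -> 0 < a -> 0 <= B <= 1 ->
  Rabs (w - w' - wt * (- dt)) <= M * (- dt) ^ 2 ->
  Rabs (wm - 2 * w' + wp - dS ^ 2 * wss) <= M * dS ^ 4 ->
  wt - kappa * wss + a * exp X' - b = 0 ->
  (W' - W) / dt - kappa * ((Wm - 2 * W' + Wp) / dS ^ 2)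
    + a * (exp x * (1 + y - x)) - b = 0 ->
  Rabs X <= M -> Rabs X' <= M -> Rabs (X' - X) <= M * dt -> Rabs (X - x) <= 2 * B ->
  Rabs (((w' - W') - (w - W)) / dt
        - kappa / dS ^ 2 * ((wm - Wm) - 2 * (w' - W') + (wp - Wp))
        + a * exp x * (X' - y))
    <= M * dt + kappa * (M * dS ^ 2)
       + a * (exp (M + 2) * M ^ 2 * dt + exp (M + 2) * (4 + 4 * M) * B).
Proof.
  intros Hdt HdS Hk Ha HB Ht HS Heq Hsch HX HX' HXX Hx.
  pose proof (linearised_source_error M B X X' x y HB HX HX' Hx) as HZ.
  (* The increment is squared, of order [dt ^ 2]; [dt <= 1] lowers this to the first order that is
     needed. *)
  assert (Hd2 : (X' - X) ^ 2 <= M ^ 2 * dt).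
  { rewrite <- pow2_abs.
    apply Rle_trans with ((M * dt) ^ 2).
    - apply pow_incr. split; [apply Rabs_pos|exact HXX].
    - replace ((M * dt) ^ 2) with (M ^ 2 * (dt * dt)) by ring.
      apply Rmult_le_compat_l; [apply pow2_ge_0|].
      pose proof (Rmult_le_compat_l dt dt 1 ltac:(lra) ltac:(lra)). lra. }
  apply (Rmult_le_compat_l (exp (M + 2))) in Hd2; [|left; apply exp_pos].
  assert (HdS2 : 0 < dS ^ 2) by (apply pow_lt; exact HdS).
  assert (H1 : Rabs ((w' - w - wt * dt) / dt) <= M * dt).
  { apply Rabs_div_le; [lra|]. rewrite <- Rabs_Ropp.
    replace (- (w' - w - wt * dt)) with (w - w' - wt * - dt) by ring.
    replace (M * dt * dt) with (M * (- dt) ^ 2) by ring. exact Ht. }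
  assert (H2 : Rabs (kappa * ((wm - 2 * w' + wp - dS ^ 2 * wss) / dS ^ 2))
               <= kappa * (M * dS ^ 2)).
  { rewrite Rabs_mult, (Rabs_pos_eq kappa) by exact Hk.
    apply Rmult_le_compat_l; [exact Hk|]. apply Rabs_div_le; [exact HdS2|].
    replace (M * dS ^ 2 * dS ^ 2) with (M * dS ^ 4) by ring. exact HS. }
  assert (H3 : Rabs (a * (exp X' - exp x * (1 + y - x) - exp x * (X' - y)))
     <= a * (exp (M + 2) * M ^ 2 * dt + exp (M + 2) * (4 + 4 * M) * B)).
  { rewrite Rabs_mult, (Rabs_pos_eq a) by lra.
    apply Rmult_le_compat_l; lra. }
  (* The error equation is the time, space and source consistency errors plus the differential
     equation minus the scheme; the last two vanish. *)
  match goal with |- Rabs ?g <= _ =>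
    replace g with ((w' - w - wt * dt) / dt
      - kappa * ((wm - 2 * w' + wp - dS ^ 2 * wss) / dS ^ 2)
      - a * (exp X' - exp x * (1 + y - x) - exp x * (X' - y))
      + (wt - kappa * wss + a * exp X' - b)
      - ((W' - W) / dt - kappa * ((Wm - 2 * W' + Wp) / dS ^ 2)
         + a * (exp x * (1 + y - x)) - b)) by (field; lra)
  end.
  rewrite Heq, Hsch.
  apply Rabs_le_between in H1, H2, H3. apply Rabs_le_between. lra.
Qed.

(** * Choice of constants and induction over the time levels *)

Theorem theorem3 (sigma gamma T Smax mu nu01 nu10 : R)
    (h phi_l phi_r : R -> R) (u v : R -> R -> R)
    (hsigma : 0 < sigma) (hgamma : 0 < gamma) (hT : 0 < T) (hSmax : 0 < Smax)
    (hnu01 : 0 < nu01) (hnu10 : 0 < nu10)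
    (hsol : is_IBVP_solution sigma gamma T Smax
              nu01 (mu ^ 2 / (2 * sigma ^ 2) + nu01) nu10 h phi_l phi_r u v)
    (hu : C24 T Smax u) (hv : C24 T Smax v) :
  exists C delta : R, 0 < C /\ 0 < delta /\
    forall (I J : nat) (dS dt : R) (U V : nat -> nat -> R),
      is_mesh T Smax I J dS dt -> dS <= delta -> dt <= delta ->
      is_scheme_solution sigma gamma
        nu01 (mu ^ 2 / (2 * sigma ^ 2) + nu01) nu10 h phi_l phi_r
        I J dS dt U V ->
      grid_max I J (fun i j => Rabs (u (INR j * dt) (INR i * dS) - U i j))
      + grid_max I J (fun i j => Rabs (v (INR j * dt) (INR i * dS) - V i j))
      <= C * (dt + dS ^ 2).
Proof.
  set (b := mu ^ 2 / (2 * sigma ^ 2) + nu01) in *. clearbody b.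
  rename nu01 into a, nu10 into c.
  destruct hsol as [(ut0 & us0 & uss0 & vt0 & Hut0 & Hus0 & Huss0 & Hvt0 & Heq)
                    [Hinit Hbd]].
  destruct (C24_bounds _ _ _ hu)
    as (ut & us & uss & Mu & HMu & Hut & Hus & Huss & Bu & Lu & Tu & Su).
  destruct (C24_bounds _ _ _ hv)
    as (vt & vs & vss & Mv & HMv & Hvt & _ & _ & Bv & Lv & Tv & _).
  (* The equations are rewritten with the derivatives for which the Taylor estimates hold. The term
     [0 * 0] gives the second one the form expected by [scheme_residual]. *)
  assert (Eqs : forall t s, QT T Smax (t, s) ->
     ut t s - 1 / 2 * sigma ^ 2 * s ^ 2 * uss t s + a * exp (u t s - v t s) - b = 0 /\
     vt t s - 0 * 0 + c * exp (v t s - u t s) - c = 0).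
  { intros t s Hq. destruct (Heq t s Hq) as [E1 E2].
    (* [uss0] differentiates [us0] and [uss] differentiates [us], so the first derivatives must
       agree along the whole interval before the second ones can be compared. *)
    assert (Qus : forall y, Icc 0 Smax y -> us0 t y = us t y).
    { intros y Hy. assert (Hqy : QT T Smax (t, y)) by (split; [apply Hq|exact Hy]).
      exact (D_in_Icc_unique 0 Smax y _ _ _ hSmax Hy (Hus0 t y Hqy) (Hus t y Hqy)). }
    rewrite <- (D_in_Icc_unique 0 T t _ _ _ hT (proj1 Hq) (Hut0 t s Hq) (Hut t s Hq)).
    rewrite <- (D_in_Icc_unique 0 T t _ _ _ hT (proj1 Hq) (Hvt0 t s Hq) (Hvt t s Hq)).
    rewrite <- (D_in_Icc_unique 0 Smax s (us t) (uss0 t) _ hSmax (proj2 Hq)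
      (D_in_congr (us0 t) (us t) (uss0 t) (uss0 t) _ s (proj2 Hq) Qus eq_refl
         (Huss0 t s Hq)) (Huss t s Hq)).
    unfold Rminus at 3. unfold Rminus at 5. rewrite !exp_plus. lra. }
  pose (M := Mu + Mv). pose (E := exp (M + 2)).
  assert (HM : 0 <= M) by (unfold M; lra).
  assert (HE : 0 < E) by apply exp_pos.
  pose (kmax := 1 / 2 * sigma ^ 2 * Smax ^ 2).
  assert (Hkmax : 0 <= kmax).
  { unfold kmax. apply Rmult_le_pos; [apply Rmult_le_pos; [lra|]|]; apply pow2_ge_0. }
  (* [K0] collects the constants of the time, space and source consistency errors, and [L] the
     growth rate. The sum [a + c] serves both equations; the summand 1 makes [K0] positive. *)
  pose (K0 := M + kmax * M + (a + c) * (E * M ^ 2) + 1).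
  pose (L := (a + c) * (E * (4 + 4 * M))).
  assert (Hac : 0 < a + c) by lra.
  assert (HEM : 0 <= E * M ^ 2) by (apply Rmult_le_pos; [lra|apply pow2_ge_0]).
  assert (HEM4 : 0 <= E * (4 + 4 * M)) by (apply Rmult_le_pos; lra).
  assert (HkM : 0 <= kmax * M) by (apply Rmult_le_pos; assumption).
  assert (HK0 : 1 <= K0).
  { pose proof (Rmult_le_pos (a + c) _ ltac:(lra) HEM). unfold K0. lra. }
  assert (HL : 0 <= L) by (apply Rmult_le_pos; lra).
  pose (A := T * K0 * exp (L * T)).
  assert (HA : 0 < A).
  { unfold A. repeat apply Rmult_lt_0_compat; try lra. apply exp_pos. }
  (* Each maximum is at most [A * (dt + dS ^ 2)], whence [2 * A]. The threshold gives [dS ^ 2 <= dS]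
     and then [A * (dt + dS ^ 2) <= 1], which keeps all [G j] below 1. *)
  exists (2 * A), (Rmin 1 (/ (2 * A))).
  assert (HiA : 0 < / (2 * A)) by (apply Rinv_0_lt_compat; lra).
  split; [lra|]. split; [apply Rmin_pos; lra|].
  intros I J dS dt U V (HI & HJ & EI & EJ) HdS1 Hdt1 (SU & SV & S0 & Sb).
  pose proof (Rmin_l 1 (/ (2 * A))). pose proof (Rmin_r 1 (/ (2 * A))).
  assert (HIpos : 0 < INR I) by (apply lt_0_INR; lia).
  assert (HJpos : 0 < INR J) by (apply lt_0_INR; lia).
  assert (HdS : 0 < dS).
  { apply Rmult_lt_reg_l with (INR I); [exact HIpos|lra]. }
  assert (Hdt : 0 < dt).
  { apply Rmult_lt_reg_l with (INR J); [exact HJpos|lra]. }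
  assert (HdS2 : 0 < dS ^ 2 <= dS).
  { split; [apply pow_lt; exact HdS|].
    pose proof (Rmult_le_compat_l dS dS 1 ltac:(lra) ltac:(lra)). simpl. lra. }
  assert (Hgrid : forall i j, (i <= I)%nat -> (j <= J)%nat ->
     QT T Smax (INR j * dt, INR i * dS)).
  { intros i j Hi Hj. apply le_INR in Hi, Hj.
    pose proof (pos_INR i). pose proof (pos_INR j).
    split; simpl; split; try (apply Rmult_le_pos; lra).
    - rewrite <- EJ. apply Rmult_le_compat_r; lra.
    - rewrite <- EI. apply Rmult_le_compat_r; lra. }
  pose (rho := K0 * (dt + dS ^ 2)).
  assert (Hrho : 0 <= rho) by (apply Rmult_le_pos; lra).
  pose (G := gronwall_bound L dt rho).
  assert (HG : forall j, (j <= J)%nat -> 0 <= G j <= A * (dt + dS ^ 2)).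
  { intros j Hj.
    replace (A * (dt + dS ^ 2)) with (T * rho * exp (L * T)) by (unfold A, rho; ring).
    apply gronwall_bound_le; try lra. apply (Hgrid 0%nat j); lia. }
  assert (Hsmall : A * (dt + dS ^ 2) <= 1).
  { replace 1 with (A * (2 * / (2 * A))) by (field; lra).
    apply Rmult_le_compat_l; lra. }
  assert (Hmain : forall j, (j <= J)%nat -> forall i, (i <= I)%nat ->
     Rabs (u (INR j * dt) (INR i * dS) - U i j) <= G j /\
     Rabs (v (INR j * dt) (INR i * dS) - V i j) <= G j).
  { induction j as [|j IH]; intros Hj.
    { intros i Hi. destruct (HG 0%nat Hj) as [G0 _].
      destruct (S0 i Hi) as [-> ->]. simpl INR. rewrite Rmult_0_l.
      destruct (Hinit (INR i * dS) (proj2 (Hgrid i 0%nat Hi Hj))) as [-> ->].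
      rewrite Rminus_diag, Rabs_R0. split; exact G0. }
    specialize (IH ltac:(lia)). destruct (HG j ltac:(lia)) as [HB0 HB1].
    replace (S j) with (j + 1)%nat in * by lia.
    pose (t := INR j * dt). pose (t' := INR (j + 1) * dt).
    assert (Ett : t' - t = dt) by (unfold t, t'; rewrite plus_INR; simpl; ring).
    assert (Ett' : t - t' = - dt) by lra.
    assert (HKB : 0 <= L * G j + rho).
    { pose proof (Rmult_le_pos _ _ HL HB0). lra. }
    pose proof (gronwall_bound_step L dt rho j HL ltac:(lra) Hrho) as HGs.
    fold G in HGs.
    assert (HX : forall i, (i <= I)%nat -> let s := INR i * dS in
      Rabs (u t s - v t s) <= M /\ Rabs (u t' s - v t' s) <= M /\
      Rabs (u t' s - v t' s - (u t s - v t s)) <= M * dt /\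
      Rabs (u t s - v t s - (U i j - V i j)) <= 2 * G j).
    { intros i Hi s.
      pose proof (Hgrid i j Hi ltac:(lia)) as Q. pose proof (Hgrid i _ Hi Hj) as Q'.
      fold t s in Q. fold t' s in Q'.
      pose proof (Bu _ _ Q) as B1. pose proof (Bu _ _ Q') as B2.
      pose proof (Bv _ _ Q) as B3. pose proof (Bv _ _ Q') as B4.
      pose proof (Lu _ _ _ Q Q') as B5. pose proof (Lv _ _ _ Q Q') as B6.
      destruct (IH i Hi) as [B7 B8]. fold t s in B7, B8.
      rewrite Ett, (Rabs_pos_eq dt) in B5, B6 by lra.
      apply Rabs_le_between in B1, B2, B3, B4, B5, B6, B7, B8.
      unfold M. repeat split; apply Rabs_le_between; lra. }
    assert (Hstep : forall i, (i <= I)%nat ->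
      Rabs (u t' (INR i * dS) - U i (j + 1)%nat) <= G j + dt * (L * G j + rho) /\
      Rabs (v t' (INR i * dS) - V i (j + 1)%nat) <= G j + dt * (L * G j + rho)).
    { apply (implicit_step_bound I dt (G j) (L * G j + rho)
        (fun i => u t (INR i * dS) - U i j) (fun i => v t (INR i * dS) - V i j)
        (fun i => u t' (INR i * dS) - U i (j + 1)%nat)
        (fun i => v t' (INR i * dS) - V i (j + 1)%nat)
        (fun i => 1 / 2 * sigma ^ 2 * (INR i * dS) ^ 2 / dS ^ 2)
        (fun i => a * exp (U i j - V i j)) (fun i => c * exp (V i j - U i j)));
        try assumption.
      - intros i. apply Rmult_le_pos; [|left; apply Rinv_0_lt_compat; lra].
        apply Rmult_le_pos; [apply Rmult_le_pos; [lra|]|]; apply pow2_ge_0.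
      - intros i. apply Rmult_le_pos; [lra|left; apply exp_pos].
      - intros i. apply Rmult_le_pos; [lra|left; apply exp_pos].
      - intros i Hi. assert (Hi' : (i <= I)%nat) by lia.
        destruct (HX i Hi') as (X1 & X2 & X3 & X4).
        assert (Em : INR (i - 1) * dS = INR i * dS - dS)
          by (rewrite minus_INR by lia; simpl; ring).
        assert (Ep : INR (i + 1) * dS = INR i * dS + dS)
          by (rewrite plus_INR; simpl; ring).
        pose proof (Hgrid i j Hi' ltac:(lia)) as Q. pose proof (Hgrid i _ Hi' Hj) as Q'.
        pose proof (Hgrid (i - 1)%nat _ ltac:(lia) Hj) as Qm.
        pose proof (Hgrid (i + 1)%nat _ ltac:(lia) Hj) as Qp.
        rewrite Em in *. rewrite Ep in *.
        fold t in Q. fold t' in Q', Qm, Qp.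
        pose proof (SU i j Hi ltac:(lia)) as Hs.
        set (s := INR i * dS) in *.
        (* The scheme is implicit, so the expansion is about the new level [t'] and the increment to
           the old one is [- dt]. *)
        pose proof (Tu _ _ _ Q' Q) as HT. rewrite Ett' in HT.
        pose proof (Su _ _ _ Q' Qm Qp) as HS.
        assert (Hk : 0 <= 1 / 2 * sigma ^ 2 * s ^ 2 <= kmax).
        { unfold kmax. split; [apply Rmult_le_pos; [apply Rmult_le_pos; [lra|]|]; apply pow2_ge_0|].
          apply Rmult_le_compat_l; [|apply pow_incr; apply Q].
          apply Rmult_le_pos; [lra|apply pow2_ge_0]. }
        replace (a * exp (U i j - V i j) * (u t' s - U i (j + 1)%nat
                   - (v t' s - V i (j + 1)%nat)))
          with (a * exp (U i j - V i j) * (u t' s - v t' s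
                   - (U i (j + 1)%nat - V i (j + 1)%nat))) by ring.
        eapply Rle_trans.
        + apply (scheme_residual dt dS _ a b M (G j) (u t s) (u t' s) (u t' (s - dS))
            (u t' (s + dS)) (ut t' s) (uss t' s) (u t s - v t s)); try lra;
            try eassumption.
          * eapply Rle_trans; [exact HT|]. apply Rmult_le_compat_r;
              [apply pow2_ge_0|unfold M; lra].
          * eapply Rle_trans; [exact HS|]. apply Rmult_le_compat_r;
              [|unfold M; lra]. left; apply pow_lt; exact HdS.
          * apply Eqs; exact Q'.
        (* Passing to [kmax] and [a + c] makes the bound independent of the node; the nonnegative
           products supply the surplus terms. *)
        + fold E. unfold L, rho, K0.
          pose proof (Rmult_le_compat_r (M * dS ^ 2) _ _
            ltac:(apply Rmult_le_pos; lra) (proj2 Hk)).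
          pose proof (Rmult_le_pos _ _ HM (Rlt_le _ _ (proj1 HdS2))).
          pose proof (Rmult_le_pos _ _ HkM (Rlt_le _ _ Hdt)).
          pose proof (Rmult_le_pos _ _ (Rmult_le_pos _ _ (Rlt_le _ _ Hac) HEM)
            (Rlt_le _ _ (proj1 HdS2))).
          pose proof (Rmult_le_pos _ _ (Rmult_le_pos _ _ (Rlt_le _ _ hnu10) HEM)
            (Rlt_le _ _ Hdt)).
          pose proof (Rmult_le_pos _ _ (Rmult_le_pos _ _ (Rlt_le _ _ hnu10) HEM4) HB0).
          lra.
      - intros i Hi.
        destruct (HX i Hi) as (X1 & X2 & X3 & X4).
        pose proof (Hgrid i j Hi ltac:(lia)) as Q. pose proof (Hgrid i _ Hi Hj) as Q'.
        fold t in Q. fold t' in Q'.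
        pose proof (SV i j Hi ltac:(lia)) as Hs.
        set (s := INR i * dS) in *.
        pose proof (Tv _ _ _ Q' Q) as HT. rewrite Ett' in HT.
        (* With [kappa = 0] the neighbours are fictitious: [2 * v t' s] and [0] make the exact
           second difference vanish, so its consistency hypothesis is trivial. *)
        match goal with |- Rabs ?g <= _ =>
          replace g with ((v t' s - V i (j + 1)%nat - (v t s - V i j)) / dt
            - 0 / dS ^ 2 * ((2 * v t' s - 0) - 2 * (v t' s - V i (j + 1)%nat) + (0 - 0))
            + c * exp (V i j - U i j) * (v t' s - u t' s
                   - (V i (j + 1)%nat - U i (j + 1)%nat))) by (field; lra)
        end.
        eapply Rle_trans.
        + apply (scheme_residual dt dS 0 c c M (G j) (v t s) (v t' s)
            (2 * v t' s) 0 (vt t' s) 0 (v t s - u t s)); try lra.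
          * eapply Rle_trans; [exact HT|]. apply Rmult_le_compat_r;
              [apply pow2_ge_0|unfold M; lra].
          * replace (2 * v t' s - 2 * v t' s + 0 - dS ^ 2 * 0) with 0 by ring.
            rewrite Rabs_R0. apply Rmult_le_pos; [exact HM|].
            left; apply pow_lt; exact HdS.
          * apply Eqs; exact Q'.
          * apply Rabs_le_between in X1. apply Rabs_le_between. lra.
          * apply Rabs_le_between in X2. apply Rabs_le_between. lra.
          * apply Rabs_le_between in X3. apply Rabs_le_between. lra.
          * apply Rabs_le_between in X4. apply Rabs_le_between. lra.
        + fold E. unfold L, rho, K0.
          pose proof (Rmult_le_pos _ _ HM (Rlt_le _ _ (proj1 HdS2))).
          pose proof (Rmult_le_pos _ _ HkM (Rlt_le _ _ Hdt)).
          pose proof (Rmult_le_pos _ _ HkM (Rlt_le _ _ (proj1 HdS2))).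
          pose proof (Rmult_le_pos _ _ (Rmult_le_pos _ _ (Rlt_le _ _ Hac) HEM)
            (Rlt_le _ _ (proj1 HdS2))).
          pose proof (Rmult_le_pos _ _ (Rmult_le_pos _ _ (Rlt_le _ _ hnu01) HEM)
            (Rlt_le _ _ Hdt)).
          pose proof (Rmult_le_pos _ _ (Rmult_le_pos _ _ (Rlt_le _ _ hnu01) HEM4) HB0).
          lra.
      (* The scheme takes the exact boundary data for [U], so this error vanishes at both ends. *)
      - destruct (Sb _ Hj) as [-> _]. simpl INR. rewrite Rmult_0_l.
        destruct (Hbd t' (proj1 (Hgrid 0%nat _ ltac:(lia) Hj))) as [-> _].
        unfold t'. ring.
      - destruct (Sb _ Hj) as [_ ->]. rewrite EI.
        destruct (Hbd t' (proj1 (Hgrid 0%nat _ ltac:(lia) Hj))) as [_ ->].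
        unfold t'. ring. }
    intros i Hi. specialize (Hstep i Hi). fold t'. lra. }
  assert (Hg1 := grid_max_le I J
    (fun i j => Rabs (u (INR j * dt) (INR i * dS) - U i j)) (A * (dt + dS ^ 2))).
  assert (Hg2 := grid_max_le I J
    (fun i j => Rabs (v (INR j * dt) (INR i * dS) - V i j)) (A * (dt + dS ^ 2))).
  cbv beta in Hg1, Hg2.
  apply Rle_trans with (A * (dt + dS ^ 2) + A * (dt + dS ^ 2)); [|lra].
  apply Rplus_le_compat; [apply Hg1|apply Hg2]; intros i j Hi Hj;
    eapply Rle_trans; try apply (Hmain j Hj i Hi); apply HG, Hj.
Qed.
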